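(* Let $n\ge1$ be an integer, let $0<s<n$, and let $1\le p,q\le\infty$ and $r$ satisfy $\frac1p+\frac1q=\frac1r\le 1$. Then the bilinear Bessel potential $\mathcal J_s$ is bounded $$\mathcal J_s: L^p(\mathbb R^n)\times L^q(\mathbb R^n)\longrightarrow L^r(\mathbb R^n).$$
   Context: For $0<s<n$, $G_s$ denotes the Bessel kernel of order $s$ on $\mathbb R^n$: the nonnegative integrable function whose Fourier transform (with convention $\widehat{h}(\xi)=\int h(x)e^{-2\pi i x\cdot\xi}\,dx$) is $\widehat{G_s}(\xi)=(1+4\pi^2|\xi|^2)^{-s/2}$. The bilinear Bessel potential is $$\mathcal J_s(f,g)(x)=\int_{\mathbb R^n}G_s(y)\,f(x-y)\,g(x+y)\,dy .$$ Saying that $\mathcal J_s: X\times Y\to Z$ is bounded means that there is a finite constant $C$ such that, for all $f\in X$, $g\in Y$, the defining integral converges absolutely for a.e. $x$ and $\|\mathcal J_s(f,g)\|_Z\le C\|f\|_X\|g\|_Y$. Convention: $1/\infty=0$. *)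

(* Defs.v *)
From HB Require Import structures.
From mathcomp Require Import all_boot all_order all_algebra.
From mathcomp Require Import all_classical all_reals all_analysis.
From mathcomp Require Import complex.
Set Implicit Arguments.
Unset Strict Implicit.
Unset Printing Implicit Defensive.
Import Order.TTheory GRing.Theory Num.Theory.
Import numFieldNormedType.Exports.
Local Open Scope classical_set_scope.
Local Open Scope ring_scope.

(** Row vectors carry the sigma-algebra generated by the coordinates, as
    [n.-tuple T] does in the library; for [T := R] it is the Borel one. *)

Definition rV_display : measure_display -> measure_display.
Proof. exact. Qed.

Section measurable_rV.
Context {d : measure_display} {T : measurableType d}.
Variable n : nat.

Let coors : 'I_n -> 'rV[T]_n -> T := fun i x => x ord0 i.

Let rV_set0 : g_sigma_preimage coors set0.
Proof. exact: sigma_algebra0. Qed.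

Let rV_setC A : g_sigma_preimage coors A -> g_sigma_preimage coors (~` A).
Proof. exact: sigma_algebraC. Qed.

Let rV_bigcup (F : _^nat) : (forall i, g_sigma_preimage coors (F i)) ->
  g_sigma_preimage coors (\bigcup_i (F i)).
Proof. exact: sigma_algebra_bigcup. Qed.

HB.instance Definition _ := @isMeasurable.Build (rV_display d)
  'rV[T]_n (g_sigma_preimage coors) rV_set0 rV_setC rV_bigcup.

Lemma measurable_coord_rV (i : 'I_n) :
  measurable_fun [set: 'rV[T]_n] (fun x : 'rV[T]_n => x ord0 i).
Proof.
move=> _ Y mY; rewrite setTI; apply: sub_sigma_algebra => /=.
rewrite -bigcup_seq/=; exists i => /=; first by rewrite mem_index_enum.
by exists Y => //; rewrite setTI.
Qed.

Lemma measurable_fun_rV d1 (T1 : measurableType d1) (f : T1 -> 'rV[T]_n) :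
  (forall i, measurable_fun [set: T1] (fun x => f x ord0 i)) ->
  measurable_fun [set: T1] f.
Proof.
move=> mf.
suff H : g_sigma_preimage (fun i => coors i \o f) `<=` measurable.
  rewrite g_sigma_preimage_comp in H.
  by move=> _ A mA; apply: H; exists A.
apply: smallest_sub; first exact: sigma_algebra_measurable.
rewrite -bigcup_seq/=; apply: bigcup_sub => i _.
by move=> A [B mB <-]; exact: mf.
Qed.

End measurable_rV.

Section lebesgue_rV.
Context {R : realType}.

Definition rV_cons n (x : R * 'rV[R]_n) : 'rV[R]_n.+1 :=
  \row_i (if unlift ord0 i is Some j then x.2 ord0 j else x.1).

Definition rV_uncons n (v : 'rV[R]_n.+1) : R * 'rV[R]_n :=
  (v ord0 ord0, \row_j v ord0 (lift ord0 j)).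

Lemma rV_consK n : cancel (@rV_cons n) (@rV_uncons n).
Proof.
move=> [x v]; rewrite /rV_uncons !mxE unlift_none/=; congr pair.
by apply/rowP => j; rewrite !mxE liftK.
Qed.

Lemma measurable_rV_cons n : measurable_fun setT (@rV_cons n).
Proof.
apply: measurable_fun_rV => i; under eq_fun do rewrite mxE.
case: (unlift ord0 i) => [j|]; last exact: measurable_fst.
apply: (@measurableT_comp _ _ _ _ _ _ (fun v : 'rV[R]_n => v ord0 j)) => //.
exact: measurable_coord_rV.
Qed.

Lemma measurable_rV_uncons n : measurable_fun setT (@rV_uncons n).
Proof.
apply: measurable_fun_pair; first exact: measurable_coord_rV.
apply: measurable_fun_rV => i; under eq_fun do rewrite mxE.
exact: measurable_coord_rV.
Qed.

Section step.
Variables (n : nat) (mu : {sigma_finite_measure set 'rV[R]_n -> \bar R}).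

Definition lebesgue_rV_step : set 'rV[R]_n.+1 -> \bar R :=
  pushforward (lebesgue_measure \x mu)%E (@rV_cons n).

HB.instance Definition _ := Measure.copy lebesgue_rV_step
  (measure_function_pushforward__canonical__measure_function_Measure
     (lebesgue_measure \x mu)%E (@measurable_rV_cons n)).

Let lebesgue_rV_step_sigma_finite : sigma_finite setT lebesgue_rV_step.
Proof.
pose l : {sigma_finite_measure set (measurableTypeR R) -> \bar R} :=
  lebesgue_measure.
have /sigma_finiteP[F [TF ndF Foo]] := sigma_finiteT l.
have /sigma_finiteP[G [TG ndG Goo]] := sigma_finiteT mu.
exists (fun k => @rV_uncons n @^-1` (F k `*` G k)).
  apply/esym; rewrite -subTset => v _.
  have [i _ Fi] : (\bigcup_i F i) (rV_uncons v).1 by rewrite -TF.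
  have [j _ Gj] : (\bigcup_j G j) (rV_uncons v).2 by rewrite -TG.
  exists (maxn i j) => //; split.
    by move: Fi; exact/subsetPset/ndF/leq_maxl.
  by move: Gj; exact/subsetPset/ndG/leq_maxr.
move=> k; have [mF Fk] := Foo k; have [mG Gk] := Goo k; split.
  rewrite -[X in measurable X]setTI; apply: measurable_rV_uncons => //.
  exact: measurableX.
rewrite /lebesgue_rV_step /pushforward -comp_preimage.
rewrite (_ : _ \o _ = id); last by apply/funext => x /=; rewrite rV_consK.
by rewrite preimage_id product_measure1E// lte_mul_pinfty// ge0_fin_numE.
Qed.

HB.instance Definition _ := @Measure_isSigmaFinite.Build _ _ _
  lebesgue_rV_step lebesgue_rV_step_sigma_finite.

End step.

(** Iterated product measure along R x R^n -> R^(n+1); [lebesgue_rV_box] gives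
    its value on boxes, which characterizes it. *)
Fixpoint lebesgue_rV n : {sigma_finite_measure set 'rV[R]_n -> \bar R} :=
  if n is m.+1 then lebesgue_rV_step (lebesgue_rV m) else \d_(0 : 'rV[R]_0).

Lemma lebesgue_rV_box n (A : 'I_n -> set R) : (forall i, measurable (A i)) ->
  lebesgue_rV n [set v | forall i, A i (v ord0 i)] =
  (\prod_(i < n) lebesgue_measure (A i))%E.
Proof.
elim: n A => [|n IHn] A mA.
  rewrite big_ord0 /= diracE mem_set//=.
  by move=> [].
pose B : set 'rV[R]_n := [set v | forall i, A (lift ord0 i) (v ord0 i)].
rewrite big_ord_recl -(IHn (fun i => A (lift ord0 i)))// -/B.
rewrite /= /lebesgue_rV_step /pushforward.
have mB : measurable B.
  have -> : B = \big[setI/setT]_(i < n)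
      ((fun v : 'rV[R]_n => v ord0 i) @^-1` A (lift ord0 i)).
    rewrite -bigcap_seq; apply/seteqP; split => v Bv i.
      by move=> _; exact: Bv.
    by apply: (Bv i); rewrite /= mem_index_enum.
  apply: bigsetI_measurable => i _.
  by rewrite -[X in measurable X]setTI; exact: measurable_coord_rV.
suff -> : @rV_cons n @^-1` [set v | forall i, A i (v ord0 i)] = A ord0 `*` B.
  by rewrite product_measure1E; [|exact: mA|exact: mB].
apply/seteqP; split => [[x v] /= xv|[x v] /= [Ax Bv] i].
  split=> [|i]; first by have := xv ord0; rewrite mxE unlift_none.
  by have := xv (lift ord0 i); rewrite mxE liftK.
by rewrite mxE; case: unliftP => [j ->|->].
Qed.

End lebesgue_rV.

Section complex_functions.
Context {d : measure_display} {T : measurableType d} {R : realType}.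
Variable mu : {measure set T -> \bar R}.
Implicit Types (h : T -> R[i]) (p : \bar R).

Definition cabs (z : R[i]) : R := ComplexField.Normc.normc z.

Definition cmeasurable h : Prop :=
  measurable_fun setT (@complex.Re R \o h) /\
  measurable_fun setT (@complex.Im R \o h).

Definition cintegrable h : Prop :=
  cmeasurable h /\ (\int[mu]_x (cabs (h x))%:E < +oo)%E.

(** Junk value when [h] is not [cintegrable]. *)
Definition cintegral h : R[i] :=
  Complex (Rintegral mu setT (@complex.Re R \o h))
          (Rintegral mu setT (@complex.Im R \o h)).

Definition cLnorm p h : \bar R := 'N[mu]_p[EFin \o (cabs \o h)]%E.

Definition cLspace p : set (T -> R[i]) :=
  [set h | cmeasurable h /\ (cLnorm p h < +oo)%E].

End complex_functions.

Section bessel.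
Context {R : realType} {n : nat}.
Implicit Types (x y xi : 'rV[R]_n) (f g h : 'rV[R]_n -> R[i]).

(** The norm [`|x|] of the library on row vectors is the sup norm; [dot_rV x x] is the
    squared Euclidean norm. *)
Definition dot_rV x y : R := \sum_(i < n) x ord0 i * y ord0 i.

Definition expi (t : R) : R[i] := Complex (cos t) (sin t).

Definition fourier h xi : R[i] :=
  cintegral (lebesgue_rV n) (fun x => h x * expi (- (2 * pi * dot_rV x xi))).

(** This determines [G] up to Lebesgue-null sets; any representative will do,
    since changing [G] on a null set leaves the potential unchanged. *)
Definition is_bessel_kernel (s : R) (G : 'rV[R]_n -> R) : Prop :=
  [/\ forall x, 0 <= G x,
      (lebesgue_rV n).-integrable setT (EFin \o G) &
      forall xi, fourier (fun x => real_complex R (G x)) xi =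
        real_complex R ((1 + 4 * pi ^+ 2 * dot_rV xi xi) `^ (- (s / 2)))].

Definition bessel_integrand (G : 'rV[R]_n -> R) f g x y : R[i] :=
  real_complex R (G y) * f (x - y) * g (x + y).

Definition bessel_potential (G : 'rV[R]_n -> R) f g x : R[i] :=
  cintegral (lebesgue_rV n) (bessel_integrand G f g x).

Definition bessel_potential_bounded (G : 'rV[R]_n -> R) (p q r : \bar R) :
    Prop :=
  exists C : R, forall f g,
    cLspace (lebesgue_rV n) p f -> cLspace (lebesgue_rV n) q g ->
    [/\ {ae lebesgue_rV n, forall x,
          cintegrable (lebesgue_rV n) (bessel_integrand G f g x)},
        cLspace (lebesgue_rV n) r (bessel_potential G f g) &
        (cLnorm (lebesgue_rV n) r (bessel_potential G f g) <=
         C%:E * cLnorm (lebesgue_rV n) p f * cLnorm (lebesgue_rV n) q g)%E].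

End bessel.

(* Main.v *)
Require Import Defs.
From mathcomp Require Import all_boot all_order all_algebra.
From mathcomp Require Import all_classical all_reals all_analysis.
From mathcomp Require Import measurable_realfun ess_sup_inf hoelder complex.
From mathcomp Require Import ring.
Import Order.TTheory GRing.Theory Num.Theory.
Import numFieldNormedType.Exports.
Local Open Scope classical_set_scope.
Local Open Scope ring_scope.
Set Implicit Arguments.
Unset Strict Implicit.
Unset Printing Implicit Defensive.

(** Every nonnegative kernel [G] with a finite integral [a] gives a bounded
    operator, with constant [2 a] ([integrable_kernel_bessel_bounded]).

    Put [k (x, y) = |f (x - y)| |g (x + y)|].  For a fixed [y], the functions
    [|f (x - y)|] and [|g (x + y)|] of [x] are translates of [|f|] and [|g|], so
    their norms are those of [f] and [g] ([Lnorm_translation]), and the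
    inequality of Hoelder with three exponents ([hoelder_Lnorm]) bounds the
    [L^r] norm of [k (., y)] by [M = ||f||_p ||g||_q], uniformly in [y].  Since
    [r >= 1], an average of functions of norm at most [M] against a weight of
    total mass [a] has norm at most [a M] ([minkowski_weighted]).

    It remains to return to the complex-valued integral, for which
    [|int h| <= 2 int |h|] ([le_cabs_cintegral]) is enough, a constant factor
    being harmless: [|J_s (f, g)|] is dominated everywhere by
    [S x = int 2 G y k (x, y) dy], whose norm is at most [2 a M].  In particular
    [S] is finite almost everywhere, which is the absolute convergence of the
    defining integral. *)

(** * Translation invariance of Lebesgue measure *)

Section translation.
Context {R : realType}.

(** Lebesgue measure is determined by its values on half-open intervals, and a
    translate of such an interval is one of the same length. *)
Lemma lebesgue_measure_translation (a : R) (A : set (measurableTypeR R)) :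
  measurable A ->
  lebesgue_measure ((fun x : measurableTypeR R => x + a) @^-1` A) =
  lebesgue_measure A.
Proof.
move=> mA.
pose t (x : measurableTypeR R) : measurableTypeR R := x + a.
have mt : measurable_fun setT t by exact: measurable_funD.
pose nu := measure_function_pushforward__canonical__measure_function_Measure
  (@lebesgue_measure R) mt.
transitivity (nu A) => //; symmetry.
apply: lebesgue_measure_unique mA => X [[x y] _ <-] /=.
rewrite /pushforward.
rewrite (_ : _ @^-1` _ = `]x - a, y - a]%classic); last first.
  by apply/seteqP; split => z /=; rewrite /t !in_itv/= ltrBlDr lerBrDr.
rewrite !lebesgue_measure_itv/= !lte_fin ltrD2r; case: ifP => // _.
by rewrite -!EFinB opprB addrA subrK.
Qed.

Lemma measurable_rV_add d (T : measurableType d) n (u v : T -> 'rV[R]_n) :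
  measurable_fun setT u -> measurable_fun setT v ->
  measurable_fun setT (fun x => u x + v x).
Proof.
move=> mu mv; apply: measurable_fun_rV => i; under eq_fun do rewrite mxE.
by apply: measurable_funD;
  apply: (measurableT_comp (@measurable_coord_rV _ _ n i)).
Qed.

Lemma measurable_rV_opp d (T : measurableType d) n (u : T -> 'rV[R]_n) :
  measurable_fun setT u -> measurable_fun setT (fun x => - u x).
Proof.
move=> mu; apply: measurable_fun_rV => i; under eq_fun do rewrite mxE.
apply: measurableT_comp => //.
by apply: (measurableT_comp (@measurable_coord_rV _ _ n i)).
Qed.

Lemma measurable_translation_rV n (v : 'rV[R]_n) :
  measurable_fun setT (fun x : 'rV[R]_n => x + v).
Proof. by apply: measurable_rV_add => //; exact: measurable_id. Qed.

(** By induction on the dimension: in the coordinates [R * R^n] the translation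
    acts separately on the two factors, so it preserves the measure of
    rectangles, and those determine the product measure. *)
Lemma lebesgue_rV_translation n (v : 'rV[R]_n) (A : set 'rV[R]_n) :
  measurable A ->
  lebesgue_rV n ((fun x => x + v) @^-1` A) = lebesgue_rV n A.
Proof.
elim: n v A => [|n IHn] v A mA.
  by congr (lebesgue_rV 0 _); rewrite [v]thinmx0;
    apply/seteqP; split => x /=; rewrite addr0.
pose a := v ord0 ord0; pose w : 'rV[R]_n := \row_j v ord0 (lift ord0 j).
pose t (z : measurableTypeR R * 'rV[R]_n) : measurableTypeR R * 'rV[R]_n :=
  (z.1 + a, z.2 + w).
have mt : measurable_fun setT t.
  apply: measurable_fun_pair; first exact: measurable_funD.
  by apply: measurable_rV_add => //; exact: measurable_snd.
have consD z : rV_cons z + v = rV_cons (t z).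
  apply/rowP => i; rewrite !mxE; case: unliftP => [j ->|->] //=.
  by rewrite !mxE.
rewrite /= /lebesgue_rV_step /pushforward.
have -> : @rV_cons R n @^-1` ((fun x => x + v) @^-1` A) =
    t @^-1` (@rV_cons R n @^-1` A).
  by apply/seteqP; split => z /=; rewrite consD.
pose nu := measure_function_pushforward__canonical__measure_function_Measure
  (@lebesgue_measure R \x lebesgue_rV n)%E mt.
set D := _ @^-1` A; transitivity (nu D) => //; symmetry.
apply: product_measure_unique => [B C mB mC|]; last first.
  by rewrite -[X in measurable X]setTI; exact: measurable_rV_cons.
rewrite /nu /= /pushforward.
have -> : t @^-1` (B `*` C) = ((fun x : measurableTypeR R => x + a) @^-1` B) `*`
    ((fun x => x + w) @^-1` C) by apply/seteqP; split => -[].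
have mB' : measurable ((fun x : measurableTypeR R => x + a) @^-1` B).
  by rewrite -[X in measurable X]setTI; exact: measurable_funD.
have mC' : measurable ((fun x => x + w) @^-1` C).
  by rewrite -[X in measurable X]setTI; exact: measurable_translation_rV.
rewrite product_measure1E// IHn//; congr (_ * _)%E.
exact: lebesgue_measure_translation.
Qed.

End translation.

(** * Norms and the inequality of Hoelder *)

Lemma le_poweR (R : realType) (r : R) (x y : \bar R) : (0 <= r)%R ->
  (0 <= x)%E -> (x <= y)%E -> (x `^ r <= y `^ r)%E.
Proof.
move=> r0 x0 xy; apply: gt0_ler_poweR => //; rewrite in_itv/= leey andbT//.
exact: le_trans xy.
Qed.

Section Lnorm_lemmas.
Context d (T : measurableType d) (R : realType).
Variable mu : {measure set T -> \bar R}.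
Local Open Scope ereal_scope.
Implicit Types (f g : T -> R) (u v : T -> \bar R) (p q r : \bar R).

Local Notation "'N_ p [ f ]" := (Lnorm mu p f).

Lemma ae_le_Lnormy u : \forall x \ae mu, `|u x| <= 'N_+oo[u].
Proof.
rewrite unlock /Lnorm; case: ifPn => [_|]; first exact: ess_sup_ge.
rewrite -leNgt measure_le0 => /eqP mu0.
by exists setT; split.
Qed.

Lemma Lnormy_le u M : 0 <= M -> (\forall x \ae mu, `|u x| <= M) ->
  'N_+oo[u] <= M.
Proof.
by move=> M0 uM; rewrite unlock /Lnorm; case: ifPn => // _; exact/ess_supP.
Qed.

(** Bounds on [L^r] norms are proved after raising to the power [r], where they
    become bounds on integrals. *)
Lemma Lnorm_leE u (r : R) (A : \bar R) : (0 < r)%R -> 0 <= A ->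
  ('N_r%:E[u] <= A) = (\int[mu]_x `|u x| `^ r <= A `^ r).
Proof.
move=> r0 A0; rewrite -poweR_Lnorm ?gt_eqF//; apply/idP/idP => H.
  by apply: le_poweR; [exact: ltW|exact: Lnorm_ge0|].
have poweRK B : 0 <= B -> B = (B `^ r) `^ r^-1.
  by move=> B0; rewrite -poweRrM mulfV ?gt_eqF// poweRe1.
rewrite (poweRK A)// (poweRK _ (Lnorm_ge0 mu _ _)).
by apply: le_poweR; rewrite ?poweR_ge0// invr_ge0 ltW.
Qed.

Lemma measurable_abse_poweR u (r : R) : measurable_fun setT u ->
  measurable_fun setT (fun x => `|u x| `^ r).
Proof.
move=> mfu; apply: (@measurableT_comp _ _ _ _ _ _ (fun x => x `^ r)) => //.
  exact: measurable_poweR.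
exact: measurableT_comp.
Qed.

Lemma le_Lnorm u v p : 0 < p ->
  measurable_fun setT u -> measurable_fun setT v ->
  (\forall x \ae mu, `|u x| <= `|v x|) -> 'N_p[u] <= 'N_p[v].
Proof.
case: p => [p p0|_|//] mfu mv uv.
  rewrite lte_fin in p0; rewrite Lnorm_leE ?Lnorm_ge0// poweR_Lnorm ?gt_eqF//.
  apply: ae_ge0_le_integral => //.
  - by move=> x _; exact: poweR_ge0.
  - exact: measurable_abse_poweR.
  - by move=> x _; exact: poweR_ge0.
  - exact: measurable_abse_poweR.
  apply: filterS uv => x uv _.
  by apply: le_poweR => //; exact: ltW.
apply: Lnormy_le; first exact: Lnorm_ge0.
have := ae_le_Lnormy v; apply: filterS2 uv => x uv; exact: le_trans.
Qed.

Lemma ae_fin_Lnorm u p : 0 < p -> measurable_fun setT u ->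
  'N_p[u] < +oo -> \forall x \ae mu, `|u x| < +oo.
Proof.
case: p => [p p0|_|//] mfu uoo.
  rewrite lte_fin in p0.
  have : mu.-integrable setT (fun x => `|u x| `^ p).
    apply/integrableP; split; first exact: measurable_abse_poweR.
    under eq_integral do rewrite gee0_abs ?poweR_ge0//.
    by rewrite -poweR_Lnorm ?gt_eqF// poweR_lty.
  move/integrable_ae => /(_ measurableT); apply: filterS => x /(_ I).
  rewrite ge0_fin_numE ?poweR_ge0//.
  by apply: lty_poweRy; rewrite gt_eqF.
by have := ae_le_Lnormy u; apply: filterS => x /le_lt_trans; exact.
Qed.

Lemma Lnorm_powR f (p r : R) : (0 < p)%R -> (0 < r)%R ->
  'N_(p / r)%:E[EFin \o (fun x => `|f x| `^ r)%R] = 'N_p%:E[EFin \o f] `^ r.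
Proof.
move=> p0 r0; rewrite unlock /Lnorm invf_div [(r / p)%R]mulrC poweRrM.
congr ((_ `^ _) `^ _); apply: eq_integral => x _ /=.
by rewrite ger0_norm ?powR_ge0// -powRrM mulrCA divff ?mulr1 ?gt_eqF.
Qed.

(** [|f g| <= |f| M] almost everywhere, with [M] the [L^oo] norm of [g]; its
    finiteness lets [M] be a real factor of the integrand. *)
Lemma hoelder_Lnormy f g p : 0 < p ->
  measurable_fun setT f -> measurable_fun setT g ->
  'N_p[EFin \o f] < +oo -> 'N_+oo[EFin \o g] < +oo ->
  'N_p[EFin \o (f \* g)%R] <= 'N_p[EFin \o f] * 'N_+oo[EFin \o g].
Proof.
move=> p0 mf mg; have := ae_le_Lnormy (EFin \o g).
have := Lnorm_ge0 mu +oo (EFin \o g).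
case: ('N_+oo[EFin \o g]) => // M; rewrite lee_fin => M0 gM foo _.
have mfg : measurable_fun setT (EFin \o (f \* g)%R).
  exact/measurable_EFinP/measurable_funM.
apply: (@le_trans _ _ 'N_p[EFin \o (fun x => f x * M)%R]).
  apply: le_Lnorm => //; first exact/measurable_EFinP/measurable_funM.
  apply: filterS gM => x; rewrite /= !lee_fin !normrM (ger0_norm M0).
  exact: ler_wpM2l.
case: p p0 foo => [p p0 _|_ _|//].
  rewrite lte_fin in p0; rewrite Lnorm_leE ?mule_ge0 ?Lnorm_ge0//.
  rewrite poweRM ?Lnorm_ge0// poweR_Lnorm ?gt_eqF//.
  under eq_integral do rewrite /= normrM powRM// (ger0_norm M0) EFinM.
  rewrite ge0_integralZr ?lee_fin ?powR_ge0//.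
  by apply: (@measurable_abse_poweR (EFin \o f)); exact/measurable_EFinP.
apply: Lnormy_le; first by rewrite mule_ge0 ?Lnorm_ge0.
have := ae_le_Lnormy (EFin \o f); apply: filterS => x fx /=.
by rewrite normrM EFinM (ger0_norm M0) lee_wpmul2r.
Qed.

(** The inequality for conjugate exponents, applied to [|f|^r] and [|g|^r] with
    the exponents [p / r] and [q / r]. *)
Lemma hoelder_Lnorm_fin f g (p q r : R) :
  (0 < p)%R -> (0 < q)%R -> (0 < r)%R -> (p^-1 + q^-1 = r^-1)%R ->
  measurable_fun setT f -> measurable_fun setT g ->
  'N_r%:E[EFin \o (f \* g)%R] <= 'N_p%:E[EFin \o f] * 'N_q%:E[EFin \o g].
Proof.
move=> p0 q0 r0 pqr mf mg.
rewrite Lnorm_leE ?mule_ge0 ?Lnorm_ge0// poweRM ?Lnorm_ge0//.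
rewrite -!Lnorm_powR//.
have mpow (h : T -> R) : measurable_fun setT h ->
    measurable_fun setT (fun x => `|h x| `^ r)%R.
  move=> mh; apply: (@measurableT_comp _ _ _ _ _ _ (@powR R ^~ r)) => //.
  exact: measurableT_comp.
apply: le_trans (hoelder mu (mpow _ mf) (mpow _ mg) _ _ _); rewrite ?divr_gt0//.
  rewrite Lnorm1 le_eqVlt; apply/orP; left; apply/eqP.
  apply: eq_integral => x _ /=.
  by rewrite normrM powRM// [in RHS]ger0_norm// mulr_ge0 ?powR_ge0.
by rewrite !invf_div -mulrDr pqr mulfV// gt_eqF.
Qed.

(** An infinite exponent on one side leaves the other one equal to [r]; if both
    are finite, so is [r]. *)
Lemma hoelder_Lnorm f g p q r : 1 <= p -> 1 <= q -> p^-1 + q^-1 = r^-1 ->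
  measurable_fun setT f -> measurable_fun setT g ->
  'N_p[EFin \o f] < +oo -> 'N_q[EFin \o g] < +oo ->
  'N_r[EFin \o (f \* g)%R] <= 'N_p[EFin \o f] * 'N_q[EFin \o g].
Proof.
move=> p1 q1 pqr mf mg foo goo.
have p0 : 0 < p by exact: lt_le_trans p1.
have q0 : 0 < q by exact: lt_le_trans q1.
have [qoo|qoo] := eqVneq q +oo.
  move: pqr goo; rewrite qoo invey adde0 => /(inv_inj (@inveK _)) <- goo.
  exact: hoelder_Lnormy.
have [poo|poo] := eqVneq p +oo.
  move: pqr foo; rewrite poo invey add0e => /(inv_inj (@inveK _)) <- foo.
  rewrite muleC (_ : (f \* g)%R = (g \* f)%R); first exact: hoelder_Lnormy.
  by apply/funext => x /=; rewrite mulrC.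
case: p p1 p0 poo foo pqr => // p p1; rewrite lte_fin => p0 _ foo.
case: q q1 q0 qoo goo => // q q1; rewrite lte_fin => q0 _ goo.
rewrite !inver !gt_eqF// -EFinD => /(congr1 inve); rewrite inveK inver.
have pq0 : (0 < p^-1 + q^-1)%R by rewrite addr_gt0 ?invr_gt0.
rewrite gt_eqF// => <-; apply: hoelder_Lnorm_fin => //.
  by rewrite invr_gt0.
by rewrite invrK.
Qed.

End Lnorm_lemmas.

(** * Translation invariance of norms *)

Section Lnorm_translation.
Context {R : realType} (n : nat).
Local Notation V := 'rV[R]_n.
Local Notation mu := (lebesgue_rV n).

Lemma ae_translation (v : V) (P : set V) :
  (\forall x \ae mu, P x) -> \forall x \ae mu, P (x + v).
Proof.
move=> [N [mN N0 PN]]; exists ((fun x => x + v) @^-1` N); split.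
- by rewrite -[X in measurable X]setTI; exact: measurable_translation_rV.
- by rewrite lebesgue_rV_translation.
- by move=> x /= Pxv; exact: PN.
Qed.

Lemma ge0_integral_translation (v : V) (f : V -> \bar R) :
  measurable_fun setT f -> (forall x, 0 <= f x)%E ->
  (\int[mu]_x f (x + v)%R = \int[mu]_x f x)%E.
Proof.
move=> mf f0; have mt := measurable_translation_rV v.
have := ge0_integral_pushforward mt mu measurableT mf (fun x _ => f0 x).
rewrite preimage_setT => <-.
apply: eq_measure_integral => A mA _; exact: lebesgue_rV_translation.
Qed.

Lemma Lnorm_translation (v : V) (f : V -> \bar R) (p : \bar R) :
  (0 < p)%E -> measurable_fun setT f ->
  'N[mu]_p[(fun x => f (x + v)%R)]%E = 'N[mu]_p[f]%E.
Proof.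
case: p => [p _|_|//] mf.
  rewrite unlock /Lnorm; congr (_ `^ _)%E.
  apply: (@ge0_integral_translation v (fun x => `|f x| `^ p)%E).
    exact: measurable_abse_poweR.
  by move=> x; exact: poweR_ge0.
have Lnormy_translation w h :
    ('N[mu]_+oo[(fun x : V => h (x + w)%R)] <= 'N[mu]_+oo[h])%E.
  apply: Lnormy_le; first exact: Lnorm_ge0.
  exact: (ae_translation w (ae_le_Lnormy mu h)).
apply/eqP; rewrite eq_le Lnormy_translation/=.
(* the reverse inequality is the same one, for the opposite translation *)
have := Lnormy_translation (- v) (fun x => f (x + v)).
rewrite (_ : (fun x => f (x - v + v)) = f)//.
by apply/funext => x; rewrite subrK.
Qed.

End Lnorm_translation.

(** * Averages of functions of bounded norm *)

Section weighted_integral.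
Context d (Y : measurableType d) (R : realType).
Variable nu : {measure set Y -> \bar R}.
Local Open Scope ereal_scope.

(** Jensen's inequality for a weight of mass [a] that need not be [1].  With [q]
    the conjugate exponent of [r], it is the inequality of Hoelder for the
    factorization [G k = G^(1/q) (G^(1/r) k)]; at [r = 1], where [q] would be
    infinite, it is an equality. *)
Lemma jensen_powR (G k : Y -> R) (a r : R) : (1 <= r)%R ->
  measurable_fun setT G -> measurable_fun setT k ->
  (forall y, 0 <= G y)%R -> (forall y, 0 <= k y)%R ->
  \int[nu]_y (G y)%:E = a%:E ->
  (\int[nu]_y (G y * k y)%:E) `^ r <=
  (a `^ (r - 1))%:E * \int[nu]_y (G y * k y `^ r)%:E.
Proof.
move=> r1 mG mk G0 k0 Ga.
have a0 : (0 <= a)%R.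
  by rewrite -lee_fin -Ga; apply: integral_ge0 => y _; rewrite lee_fin.
have I0 : 0 <= \int[nu]_y (G y * k y)%:E.
  by apply: integral_ge0 => y _; rewrite lee_fin mulr_ge0.
have [{}r1|r1'] := eqVneq r 1%R.
  rewrite r1 subrr powRr0 mul1e poweRe1//.
  by under [leRHS]eq_integral do rewrite powRr1//.
have r1s : (0 < r - 1)%R by rewrite subr_gt0 lt_neqAle eq_sym r1'.
have r0 : (0 < r)%R by rewrite (lt_le_trans _ r1).
pose q : R := (r / (r - 1))%R.
have q0 : (0 < q)%R by rewrite divr_gt0.
have qr : (q^-1 + r^-1 = 1)%R.
  by rewrite /q; field; rewrite !gt_eqF.
pose u y : R := (G y `^ q^-1)%R; pose v y : R := (G y `^ r^-1 * k y)%R.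
have mpow (h : Y -> R) t : measurable_fun setT h ->
    measurable_fun setT (fun y => h y `^ t)%R.
  by move=> mh; apply: (@measurableT_comp _ _ _ _ _ _ (@powR R ^~ t)).
have mv : measurable_fun setT v by apply: measurable_funM => //; exact: mpow.
have H := hoelder nu (mpow _ q^-1%R mG) mv q0 r0 qr.
have <- : 'N[nu]_1[EFin \o (u \* v)%R] = \int[nu]_y (G y * k y)%:E.
  rewrite Lnorm1; apply: eq_integral => y _ /=.
  rewrite ger0_norm ?mulr_ge0 ?powR_ge0// mulrA -powRD.
    by rewrite qr powRr1.
  by rewrite qr oner_eq0.
apply: le_trans (le_poweR (ltW r0) (Lnorm_ge0 _ _ _) H) _.
rewrite poweRM ?Lnorm_ge0// poweR_Lnorm ?gt_eqF//.
have -> : 'N[nu]_q%:E[EFin \o u] = (a `^ q^-1)%:E.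
  rewrite unlock /Lnorm -poweR_EFin -Ga; congr (_ `^ _).
  apply: eq_integral => y _ /=.
  by rewrite ger0_norm ?powR_ge0// -powRrM mulVf ?gt_eqF// powRr1.
rewrite poweR_EFin -powRrM.
have -> : (q^-1 * r = r - 1)%R by rewrite /q; field; rewrite !gt_eqF.
rewrite le_eqVlt; apply/orP; left; apply/eqP; congr (_ * _).
apply: eq_integral => y _ /=.
rewrite ger0_norm ?mulr_ge0 ?powR_ge0// powRM ?powR_ge0//.
by rewrite -powRrM mulVf ?gt_eqF// powRr1.
Qed.

End weighted_integral.

Section minkowski_weighted.
Context d d' (T : measurableType d) (Y : measurableType d') (R : realType).
Variables (mu : {sigma_finite_measure set T -> \bar R})
  (nu : {sigma_finite_measure set Y -> \bar R}).
Variables (G : Y -> R) (k : T * Y -> R) (a M : R).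
Hypotheses (mG : measurable_fun setT G) (mk : measurable_fun setT k)
  (G0 : forall y, 0 <= G y) (k0 : forall z, 0 <= k z)
  (Ga : (\int[nu]_y (G y)%:E = a%:E)%E) (M0 : 0 <= M).
Local Open Scope ereal_scope.

Let a0 : (0 <= a)%R.
Proof.
by rewrite -lee_fin -Ga; apply: integral_ge0 => y _; rewrite lee_fin.
Qed.

Let mG2 : measurable_fun setT (fun z : T * Y => G z.2).
Proof. exact: measurableT_comp. Qed.

Let mk2 x : measurable_fun setT (fun y => k (x, y)).
Proof. exact: measurableT_comp. Qed.

Let weighted_tonelli (h : T * Y -> R) (b : R) : (0 <= b)%R ->
  measurable_fun setT h ->
  (forall z, 0 <= h z)%R ->
  (forall y, \int[mu]_x (h (x, y))%:E <= b%:E) ->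
  \int[mu]_x \int[nu]_y (G y * h (x, y))%:E <= (a * b)%:E.
Proof.
move=> b0 mh h0 hb.
rewrite (fubini_tonelli (fun z : T * Y => (G z.2 * h z)%:E))//; last 2 first.
- exact/measurable_EFinP/measurable_funM.
- by move=> z; rewrite lee_fin mulr_ge0.
have mh1 y : measurable_fun setT (fun x => (h (x, y))%:E).
  by apply/measurable_EFinP; exact: measurableT_comp.
have intG y : \int[mu]_x (G y * h (x, y))%:E =
    (G y)%:E * \int[mu]_x (h (x, y))%:E.
  by rewrite -ge0_integralZl ?lee_fin//; last by move=> x _; rewrite lee_fin.
under eq_integral do rewrite /= intG.
apply: (@le_trans _ _ (\int[nu]_y ((G y)%:E * b%:E))).
  apply: ge0_le_integral => //.
  - move=> y _; rewrite mule_ge0 ?lee_fin//.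
    by apply: integral_ge0 => x _; rewrite lee_fin.
  - apply: emeasurable_funM; first exact/measurable_EFinP.
    apply: (measurable_fun_fubini_tonelli_G (fun z => (h z)%:E)) => //.
    exact/measurable_EFinP.
  - by apply: emeasurable_funM; [exact/measurable_EFinP|exact: measurable_cst].
  - by move=> y _; rewrite lee_wpmul2l ?lee_fin.
rewrite ge0_integralZr ?lee_fin ?Ga//; first exact/measurable_EFinP.
by move=> y _; rewrite lee_fin.
Qed.

(** A form of Minkowski's integral inequality, by Tonelli's theorem.  For a
    finite [r], integrate over [x] the bound of [jensen_powR].  For an infinite
    [r], compare [k] with [M]: the excess [h = max (k - M) 0] vanishes for
    almost every [x] when [y] is fixed, so for almost every [x] its average over
    [y] is zero, and there the average of [k] is at most that of [M]. *)
Lemma minkowski_weighted (r : \bar R) : 1 <= r ->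
  (forall y, 'N[mu]_r[(fun x => (k (x, y))%:E)] <= M%:E) ->
  'N[mu]_r[(fun x => \int[nu]_y (G y * k (x, y))%:E)] <= (a * M)%:E.
Proof.
have int_ge0 (h : T * Y -> R) x : (forall z, 0 <= h z)%R ->
    0 <= \int[nu]_y (G y * h (x, y))%:E.
  by move=> h0; apply: integral_ge0 => y _; rewrite lee_fin mulr_ge0.
have mI (h : T * Y -> R) : measurable_fun setT h -> (forall z, 0 <= h z)%R ->
    measurable_fun setT (fun x => \int[nu]_y (G y * h (x, y))%:E).
  move=> mh h0.
  apply: (measurable_fun_fubini_tonelli_F (fun z : T * Y => (G z.2 * h z)%:E)).
    exact/measurable_EFinP/measurable_funM.
  by move=> z; rewrite lee_fin mulr_ge0.
case: r => [r|_|//]; last first.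
  move=> kM; apply: Lnormy_le; first by rewrite lee_fin mulr_ge0.
  pose h z : R := Num.max (k z - M)%R 0%R.
  have h0 z : (0 <= h z)%R by rewrite /h le_max lexx orbT.
  have mh : measurable_fun setT h.
    by apply: measurable_maxr => //; exact: measurable_funB.
  have hM y : \int[mu]_x (h (x, y))%:E <= 0.
    rewrite le_eqVlt; apply/orP; left; apply/eqP.
    rewrite -[RHS](integral0 mu setT); apply: ge0_ae_eq_integral => //.
    - by apply/measurable_EFinP; exact: (@measurableT_comp _ _ _ _ _ _ h).
    - by move=> x _; rewrite lee_fin.
    - have := ae_le_Lnormy mu (fun x => (k (x, y))%:E).
      apply: filterS => x /le_trans/(_ (kM y)) /=.
      rewrite lee_fin ger0_norm// => kxM _.
      by congr EFin; apply/max_idPr; rewrite subr_le0.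
  have := weighted_tonelli (lexx _) mh h0 hM; rewrite mulr0 => hle0.
  have : \int[mu]_x `|\int[nu]_y (G y * h (x, y))%:E| = 0.
    under eq_integral do rewrite gee0_abs ?(int_ge0 h)//.
    by apply/eqP; rewrite eq_le hle0 integral_ge0// => x _; exact: (int_ge0 h).
  move/(ae_eq_integral_abs mu measurableT (mI _ mh h0)).
  apply: filterS => x /(_ I) hx0.
  rewrite gee0_abs ?(int_ge0 k)//.
  have mGM : measurable_fun setT (fun y => (G y * M)%:E).
    exact/measurable_EFinP/measurable_funM.
  have mh2 : measurable_fun setT (fun y => (G y * h (x, y))%:E).
    apply/measurable_EFinP/measurable_funM => //.
    exact: (@measurableT_comp _ _ _ _ _ _ h).
  apply: (@le_trans _ _ (\int[nu]_y ((G y * M)%:E + (G y * h (x, y))%:E))).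
    apply: ge0_le_integral => //.
    - by move=> y _; rewrite lee_fin mulr_ge0.
    - exact/measurable_EFinP/measurable_funM.
    - exact: emeasurable_funD.
    - move=> y _; rewrite -EFinD lee_fin -mulrDr ler_wpM2l//.
      by rewrite -lerBlDl /h le_max lexx.
  rewrite ge0_integralD//; last 2 first.
  - by move=> y _; rewrite lee_fin mulr_ge0.
  - by move=> y _; rewrite lee_fin mulr_ge0.
  rewrite hx0 adde0.
  under eq_integral do rewrite EFinM.
  rewrite ge0_integralZr ?lee_fin ?Ga//; first exact/measurable_EFinP.
  by move=> y _; rewrite lee_fin.
rewrite lee_fin => r1 kM.
have r0 : (0 < r)%R by rewrite (lt_le_trans _ r1).
rewrite Lnorm_leE ?lee_fin ?mulr_ge0//.
have mkr : measurable_fun setT (fun z => k z `^ r)%R.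
  by apply: (@measurableT_comp _ _ _ _ _ _ (@powR R ^~ r)).
have krM y : \int[mu]_x (k (x, y) `^ r)%:E <= (M `^ r)%:E.
  have := kM y; rewrite Lnorm_leE ?lee_fin//.
  by under eq_integral do rewrite /= ger0_norm//.
have := weighted_tonelli (powR_ge0 M r) mkr (fun z => powR_ge0 _ _) krM.
move=> H; apply: (@le_trans _ _ (\int[mu]_x ((a `^ (r - 1))%:E *
    \int[nu]_y (G y * k (x, y) `^ r)%:E))).
  apply: ge0_le_integral => //.
  - by move=> x _; exact: poweR_ge0.
  - by apply: measurable_abse_poweR; exact: mI.
  - apply: emeasurable_funM; first exact: measurable_cst.
    by apply: (mI (fun z => k z `^ r)%R) => // z; exact: powR_ge0.
  - by move=> x _; rewrite gee0_abs ?(int_ge0 k)//; exact: jensen_powR.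
rewrite ge0_integralZl ?lee_fin ?powR_ge0//; last 2 first.
- by apply: (mI (fun z => k z `^ r)%R) => // z; exact: powR_ge0.
- by move=> x _; apply: (int_ge0 (fun z => k z `^ r)%R) => z; exact: powR_ge0.
apply: le_trans (lee_wpmul2l _ H) _; first by rewrite lee_fin powR_ge0.
rewrite -EFinM lee_fin powRM// mulrA [(_ `^ _ * a)%R]mulrC.
by rewrite mulr_powRB1.
Qed.

End minkowski_weighted.

(** * Complex-valued functions *)

Section complex_valued.
Context d (T : measurableType d) (R : realType).
Implicit Types (z w : R[i]) (h : T -> R[i]).

Lemma cabs_ge0 z : 0 <= cabs z.
Proof. by case: z => a b; exact: sqrtr_ge0. Qed.

Lemma cabsM z w : cabs (z * w) = cabs z * cabs w.
Proof. exact: ComplexField.Normc.normcM. Qed.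

Lemma cabs_real (a : R) : cabs (real_complex R a) = `|a|.
Proof. by rewrite /cabs /= expr0n/= addr0 sqrtr_sqr. Qed.

Lemma ler_cabs_ReIm z : cabs z <= `|complex.Re z| + `|complex.Im z|.
Proof.
case: z => a b; rewrite /cabs /=.
rewrite -(ger0_norm (addr_ge0 (normr_ge0 a) (normr_ge0 b))).
rewrite -sqrtr_sqr ler_wsqrtr// sqrrD !real_normK ?num_real//.
by rewrite -addrA [X in _ <= _ + X]addrC lerD2l lerDl mulrn_wge0.
Qed.

Lemma ler_Re_cabs z : `|complex.Re z| <= cabs z.
Proof.
by case: z => a b; rewrite /cabs/= -sqrtr_sqr ler_wsqrtr// lerDl sqr_ge0.
Qed.

Lemma ler_Im_cabs z : `|complex.Im z| <= cabs z.
Proof.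
by case: z => a b; rewrite /cabs/= -sqrtr_sqr ler_wsqrtr// lerDr sqr_ge0.
Qed.

Lemma cmeasurableM h1 h2 : cmeasurable h1 -> cmeasurable h2 ->
  cmeasurable (fun x => h1 x * h2 x).
Proof.
move=> [mr1 mi1] [mr2 mi2]; split.
- rewrite (_ : _ \o _ = (fun x => complex.Re (h1 x) * complex.Re (h2 x) -
      complex.Im (h1 x) * complex.Im (h2 x))).
    by apply: measurable_funB; exact: measurable_funM.
  by apply/funext => x /=; case: (h1 x) (h2 x) => [? ?] [? ?].
- rewrite (_ : _ \o _ = (fun x => complex.Re (h1 x) * complex.Im (h2 x) +
      complex.Im (h1 x) * complex.Re (h2 x))).
    by apply: measurable_funD; exact: measurable_funM.
  by apply/funext => x /=; case: (h1 x) (h2 x) => [? ?] [? ?].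
Qed.

Lemma cmeasurable_comp d' (T' : measurableType d') (t : T' -> T) h :
  measurable_fun setT t -> cmeasurable h -> cmeasurable (h \o t).
Proof.
move=> mt [mr mi]; split; rewrite compA.
- exact: (@measurableT_comp _ _ _ _ _ _ (@complex.Re R \o h)).
- exact: (@measurableT_comp _ _ _ _ _ _ (@complex.Im R \o h)).
Qed.

Lemma cmeasurable_real (a : T -> R) : measurable_fun setT a ->
  cmeasurable (fun x => real_complex R (a x)).
Proof. by move=> ma; split => //; exact: measurable_cst. Qed.

Lemma measurable_cabs h : cmeasurable h -> measurable_fun setT (cabs \o h).
Proof.
move=> [mr mi].
rewrite (_ : _ \o _ = (fun x => (complex.Re (h x) ^+ 2 + complex.Im (h x) ^+ 2)
    `^ 2^-1)).
  apply: (@measurableT_comp _ _ _ _ _ _ (@powR R ^~ _)).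
    exact: measurable_powR.
  by apply: measurable_funD; exact: measurable_funX.
apply/funext => x; rewrite powR12_sqrt ?addr_ge0 ?sqr_ge0//=.
by case: (h x).
Qed.

(** The factor [2] comes from estimating the real and the imaginary part of the
    integral separately.  If [h] is not integrable, the right-hand side is
    infinite. *)
Lemma le_cabs_cintegral (mu : {measure set T -> \bar R}) h : cmeasurable h ->
  ((cabs (cintegral mu h))%:E <= \int[mu]_x (2 * cabs (h x))%:E)%E.
Proof.
move=> mh; have [mr mi] := mh.
have mc := measurable_cabs mh.
have le_Rint (u : T -> R) : measurable_fun setT u ->
    (forall x, `|u x| <= cabs (h x)) ->
    (`|Rintegral mu setT u|%:E <= \int[mu]_x (cabs (h x))%:E)%E.
  move=> mfu uh; apply: (@le_trans _ _ `|\int[mu]_x (u x)%:E|%E).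
    rewrite /Rintegral; case: (\int[mu]_x (u x)%:E)%E => [s||];
    by rewrite /= ?normr0 ?leey.
  apply: le_trans (le_abse_integral _ _ _) _ => //.
    exact/measurable_EFinP.
  apply: ge0_le_integral => //.
  - by apply/measurable_EFinP; exact: measurableT_comp.
  - exact/measurable_EFinP.
  - by move=> x _; rewrite lee_fin.
apply: (@le_trans _ _
  (\int[mu]_x (cabs (h x))%:E + \int[mu]_x (cabs (h x))%:E)%E).
  apply: le_trans (leeD (le_Rint _ mr _) (le_Rint _ mi _)).
  - by rewrite -EFinD lee_fin; exact: ler_cabs_ReIm.
  - by move=> x; exact: ler_Re_cabs.
  - by move=> x; exact: ler_Im_cabs.
rewrite -ge0_integralD//; last 4 first.
- by move=> x _; rewrite lee_fin cabs_ge0.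
- exact/measurable_EFinP.
- by move=> x _; rewrite lee_fin cabs_ge0.
- exact/measurable_EFinP.
by rewrite le_eqVlt; apply/orP; left; apply/eqP; apply: eq_integral => x _;
  rewrite mulr_natl mulr2n.
Qed.

End complex_valued.

Section parametric_integral.
Context d d' (T : measurableType d) (Y : measurableType d') (R : realType).
Variable nu : {sigma_finite_measure set Y -> \bar R}.

(** Tonelli's theorem gives measurability of the integrals of the positive and
    the negative part, hence of their difference, whether or not these
    integrals are finite. *)
Lemma measurable_integral_param (u : T * Y -> \bar R) : measurable_fun setT u ->
  measurable_fun setT (fun x => \int[nu]_y u (x, y))%E.
Proof.
move=> mfu.
have -> : (fun x => \int[nu]_y u (x, y))%E =
    (fubini_F nu (u^\+) \- fubini_F nu (u^\-))%E.
  apply/funext => x; rewrite [LHS]integralE /fubini_F.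
  by congr (_ - _)%E; apply: eq_integral => y _; rewrite ?funeposE ?funenegE.
apply: emeasurable_funB; apply: measurable_fun_fubini_tonelli_F => //.
- exact: measurable_funepos.
- exact: measurable_funeneg.
Qed.

Lemma cmeasurable_cintegral (h : T * Y -> R[i]) : cmeasurable h ->
  cmeasurable (fun x => cintegral nu (fun y => h (x, y))).
Proof.
move=> [mr mi].
have mfine (u : T * Y -> R) : measurable_fun setT u ->
    measurable_fun setT (fun x => Rintegral nu setT (fun y => u (x, y))).
  move=> mfu; apply: (measurableT_comp (fine_measurable measurableT)).
  apply: (measurable_integral_param (u := EFin \o u)).
  exact/measurable_EFinP.
by split; [exact: (mfine _ mr)|exact: (mfine _ mi)].
Qed.

End parametric_integral.

(** * The bilinear potential of an integrable kernel *)

Section bessel_bound.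
Context {R : realType} (n : nat).
Local Notation V := 'rV[R]_n.
Local Notation mu := (lebesgue_rV n).

Definition bessel_product (f g : V -> R[i]) (z : V * V) : R :=
  cabs (f (z.1 - z.2)) * cabs (g (z.1 + z.2)).

Lemma bessel_product_ge0 f g z : 0 <= bessel_product f g z.
Proof. by rewrite mulr_ge0 ?cabs_ge0. Qed.

Lemma cabs_bessel_integrand (G : V -> R) f g x y : (forall y, 0 <= G y) ->
  cabs (bessel_integrand G f g x y) = G y * bessel_product f g (x, y).
Proof.
by move=> G0; rewrite /bessel_integrand !cabsM cabs_real ger0_norm// -mulrA.
Qed.

Lemma measurable_sub_rV : measurable_fun setT (fun z : V * V => z.1 - z.2).
Proof.
apply: measurable_rV_add; first exact: measurable_fst.
by apply: measurable_rV_opp; exact: measurable_snd.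
Qed.

Lemma measurable_add_rV : measurable_fun setT (fun z : V * V => z.1 + z.2).
Proof.
by apply: measurable_rV_add; [exact: measurable_fst|exact: measurable_snd].
Qed.

Lemma measurable_bessel_product f g : cmeasurable f -> cmeasurable g ->
  measurable_fun setT (bessel_product f g).
Proof.
move=> mf mg; apply: measurable_funM.
- exact: (measurableT_comp (measurable_cabs mf) measurable_sub_rV).
- exact: (measurableT_comp (measurable_cabs mg) measurable_add_rV).
Qed.

Lemma cmeasurable_bessel_integrand (G : V -> R) f g : measurable_fun setT G ->
  cmeasurable f -> cmeasurable g ->
  cmeasurable (fun z : V * V => bessel_integrand G f g z.1 z.2).
Proof.
move=> mG mf mg; apply: cmeasurableM; first apply: cmeasurableM.
- apply: (@cmeasurable_real _ _ _ (fun z : V * V => G z.2)).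
  by apply: measurableT_comp => //; exact: measurable_snd.
- exact: (cmeasurable_comp measurable_sub_rV mf).
- exact: (cmeasurable_comp measurable_add_rV mg).
Qed.

(** Hoelder's inequality in [x] for a fixed [y]: both factors are translates. *)
Lemma Lnorm_bessel_product f g (p q r : \bar R) (y : V) :
  (1 <= p)%E -> (1 <= q)%E -> (p^-1 + q^-1 = r^-1)%E ->
  cLspace mu p f -> cLspace mu q g ->
  ('N[mu]_r[(fun x => (bessel_product f g (x, y))%:E)] <=
   cLnorm mu p f * cLnorm mu q g)%E.
Proof.
move=> p1 q1 pqr [mf fp] [mg gq].
have p0 : (0 < p)%E by exact: lt_le_trans p1.
have q0 : (0 < q)%E by exact: lt_le_trans q1.
have mcf := measurable_cabs mf; have mcg := measurable_cabs mg.
have Ef : 'N[mu]_p[EFin \o (fun x : V => cabs (f (x - y)%R))]%E = cLnorm mu p f.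
  by apply: (Lnorm_translation (- y) p0); exact/measurable_EFinP.
have Eg : 'N[mu]_q[EFin \o (fun x : V => cabs (g (x + y)%R))]%E = cLnorm mu q g.
  by apply: (Lnorm_translation y q0); exact/measurable_EFinP.
rewrite -Ef -Eg; apply: hoelder_Lnorm => //.
- exact: (measurableT_comp mcf (measurable_translation_rV (- y))).
- exact: (measurableT_comp mcg (measurable_translation_rV y)).
- by rewrite Ef.
- by rewrite Eg.
Qed.

Lemma integrable_kernel_bessel_bounded (G : V -> R) (p q r : \bar R) :
  (forall y, 0 <= G y) -> mu.-integrable setT (EFin \o G) ->
  (1 <= p)%E -> (1 <= q)%E -> (1 <= r)%E -> (p^-1 + q^-1 = r^-1)%E ->
  bessel_potential_bounded G p q r.
Proof.
move=> G0 iG p1 q1 r1 pqr.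
have r0 : (0 < r)%E by exact: lt_le_trans r1.
have mG : measurable_fun setT G.
  by apply/measurable_EFinP; exact: measurable_int iG.
pose a : R := fine (\int[mu]_y (G y)%:E)%E.
have Ga : (\int[mu]_y (G y)%:E)%E = a%:E.
  by rewrite fineK//; exact: integrable_fin_num.
exists (2 * a) => f g Lf Lg; have [mf fp] := Lf; have [mg gq] := Lg.
pose k := bessel_product f g.
have mk : measurable_fun setT k by exact: measurable_bessel_product.
have k0 z : 0 <= k z by exact: bessel_product_ge0.
pose M : R := fine (cLnorm mu p f) * fine (cLnorm mu q g).
have ME : (cLnorm mu p f * cLnorm mu q g)%E = M%:E.
  by rewrite EFinM !fineK// ge0_fin_numE ?Lnorm_ge0.
have M0 : 0 <= M by rewrite mulr_ge0 ?fine_ge0 ?Lnorm_ge0.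
(* the factor 2 of le_cabs_cintegral is absorbed in the kernel *)
pose G2 y := 2 * G y.
have mG2 : measurable_fun setT G2.
  by apply: measurable_funM => //; exact: measurable_cst.
have G20 y : 0 <= G2 y by rewrite mulr_ge0.
have G2a : (\int[mu]_y (G2 y)%:E)%E = (2 * a)%:E.
  under eq_integral do rewrite EFinM.
  rewrite ge0_integralZl ?lee_fin ?Ga//; first exact/measurable_EFinP.
  by move=> y _; rewrite lee_fin.
pose S x := (\int[mu]_y (G2 y * k (x, y))%:E)%E.
have mS : measurable_fun setT S.
  apply: (@measurable_integral_param _ _ _ _ _ mu (fun z => (G2 z.2 * k z)%:E)).
  apply/measurable_EFinP/measurable_funM => //.
  by apply: measurableT_comp => //; exact: measurable_snd.
have S0 x : (0 <= S x)%E.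
  by apply: integral_ge0 => y _; rewrite lee_fin mulr_ge0.
have SM : ('N[mu]_r[S] <= (2 * a * M)%:E)%E.
  apply: minkowski_weighted => // y.
  by rewrite -ME; exact: Lnorm_bessel_product.
have mint := cmeasurable_bessel_integrand mG mf mg.
have mintx x : cmeasurable (bessel_integrand G f g x).
  exact: (cmeasurable_comp (pair1_measurable x) mint).
have SE x : S x = (\int[mu]_y (2 * cabs (bessel_integrand G f g x y))%:E)%E.
  by apply: eq_integral => y _; rewrite cabs_bessel_integrand// mulrA.
have mJ : cmeasurable (bessel_potential G f g).
  exact: (cmeasurable_cintegral mu mint).
have JM : (cLnorm mu r (bessel_potential G f g) <= (2 * a * M)%:E)%E.
  apply: le_trans SM; apply: le_Lnorm => //.
    by apply/measurable_EFinP; exact: measurable_cabs.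
  apply: aeW => x /=.
  by rewrite ger0_norm ?cabs_ge0// gee0_abs// SE; exact: le_cabs_cintegral.
split.
- have Soo : ('N[mu]_r[S] < +oo)%E by rewrite (le_lt_trans SM) ?ltry.
  have := ae_fin_Lnorm r0 mS Soo; apply: filterS => x.
  rewrite gee0_abs// SE => Sx; split => //.
  apply: le_lt_trans Sx; apply: ge0_le_integral => //.
  + by move=> y _; rewrite lee_fin cabs_ge0.
  + by apply/measurable_EFinP; exact: measurable_cabs.
  + apply/measurable_EFinP; apply: measurable_funM; first exact: measurable_cst.
    exact: measurable_cabs.
  + by move=> y _; rewrite lee_fin mulr_natl mulr2n lerDl cabs_ge0.
- by split => //; rewrite (le_lt_trans JM) ?ltry.
- by rewrite -muleA ME -EFinM.
Qed.

End bessel_bound.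

Theorem corollary4p2 (R : realType) (n : nat) (s : R) (p q r : \bar R)
    (G : 'rV[R]_n -> R) :
  (1 <= n)%N ->
  0 < s < n%:R ->
  (1 <= p)%E -> (1 <= q)%E ->
  (p^-1 + q^-1 = r^-1)%E -> (r^-1 <= 1)%E ->
  is_bessel_kernel s G ->
  bessel_potential_bounded G p q r.
Proof.
move=> _ _ p1 q1 pqr r1 [G0 iG _].
apply: integrable_kernel_bessel_bounded => //.
have rV0 : (0 <= r^-1)%E.
  by rewrite -pqr adde_ge0// inve_ge0 (le_trans _ p1, le_trans _ q1).
by move: r1; rewrite -[r in (1 <= r)%E]inveK inve_ge1.
Qed.
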